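(* For every positive integer $n$ there exists a finite Jordan-measurable coloring of $\mathbb{R}^n$ with the following property: for every positive integer $m\leq n$ there is no $m$-dimensional rectangular box in $\mathbb{R}^n$ of $m$-volume equal to $1$ with all of its $2^m$ vertices in the same color-class.
   Context: A finite coloring of $\mathbb{R}^n$ is a partition of $\mathbb{R}^n$ into finitely many sets, called color-classes. It is Jordan-measurable if the boundary of every color-class has Lebesgue measure $0$. An $m$-dimensional rectangular box in $\mathbb{R}^n$ (arbitrarily rotated) has vertices $p+\sum_{j\in T}v_j$, $T\subseteq\{1,\ldots,m\}$, where $p\in\mathbb{R}^n$ and $v_1,\ldots,v_m\in\mathbb{R}^n$ are nonzero mutually orthogonal vectors; its $m$-volume is $|v_1|\cdots|v_m|$. *)

(* Defs.v *)
From HB Require Import structures.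
From mathcomp Require Import all_boot all_order all_algebra.
From mathcomp Require Import all_classical all_reals all_analysis.
Set Implicit Arguments.
Unset Strict Implicit.
Unset Printing Implicit Defensive.
Import Order.TTheory GRing.Theory Num.Theory.
Import numFieldNormedType.Exports.
Local Open Scope classical_set_scope.
Local Open Scope ring_scope.

Definition boundary (T : topologicalType) (A : set T) : set T :=
  closure A `\` interior A.

Section Euclidean.
Variables (R : realType) (n : nat).

Definition dot (u v : 'rV[R]_n) : R := \sum_(i < n) u ord0 i * v ord0 i.

(* The library norm [`|v|] on row vectors is the sup norm; it gives the same
   topology but not the Euclidean length. *)
Definition euclid_norm (v : 'rV[R]_n) : R := Num.sqrt (dot v v).

Definition axis_box (a b : 'rV[R]_n) : set 'rV[R]_n :=
  [set x | forall i, a ord0 i <= x ord0 i <= b ord0 i].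

Definition axis_box_volume (a b : 'rV[R]_n) : R :=
  \prod_(i < n) (b ord0 i - a ord0 i).

(* n-dimensional Lebesgue measure, for n > 0: the Lebesgue outer measure, of
   which the measure is the restriction to Lebesgue measurable sets. It is only
   applied below to boundaries, which are closed and thus measurable. *)
Definition lebesgue_outer (A : set 'rV[R]_n) : \bar R :=
  ereal_inf [set s : \bar R | exists a b : nat -> 'rV[R]_n,
    [/\ forall k i, a k ord0 i <= b k ord0 i,
        A `<=` \bigcup_k axis_box (a k) (b k)
      & s = (\sum_(0 <= k <oo) (axis_box_volume (a k) (b k))%:E)%E]].

(* [P] is the set of color-classes. *)
Definition finite_coloring (P : set (set 'rV[R]_n)) : Prop :=
  finite_set P /\ classical_sets.partition P id [set: 'rV[R]_n].

Definition jordan_measurable_coloring (P : set (set 'rV[R]_n)) : Prop :=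
  finite_coloring P /\
  forall A, P A -> lebesgue_outer (boundary A) = 0%E.

Definition rectangular_edges (m : nat) (v : 'I_m -> 'rV[R]_n) : Prop :=
  (forall j, v j != 0) /\ (forall i j, i != j -> dot (v i) (v j) = 0).

Definition rectangular_box_vertices (m : nat) (p : 'rV[R]_n)
    (v : 'I_m -> 'rV[R]_n) : set 'rV[R]_n :=
  [set x | exists T : {set 'I_m}, x = p + \sum_(j in T) v j].

Definition rectangular_box_volume (m : nat) (v : 'I_m -> 'rV[R]_n) : R :=
  \prod_(j < m) euclid_norm (v j).

End Euclidean.

(* Main.v *)
(* For a direction a, the alternating sum of (a . x)^m over the vertices of a
   box with edges v_1, ..., v_m is m! * prod_j (a . v_j). Colour x by the
   residues modulo K of floor (C * (a . x)^m), for all m <= n and all a in the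
   grid {0, ..., n}^n. On a monochromatic box each alternating sum is then
   within 2^n of a multiple of K. When the edge lengths have product 1, these
   sums are bounded in terms of n and C, so for large K the multiple is 0. But
   some a in the grid satisfies |a . v_j| >= |v_j| / (2n) for all j at once
   (counting: each v_j excludes at most a fraction 1/(n+1) of the grid), and
   for that a the alternating sum exceeds 2^n once C is large. The boundaries
   of the colour classes lie in countably many hyperplanes. *)
Require Import Defs.
From HB Require Import structures.
From mathcomp Require Import all_boot all_order all_algebra.
From mathcomp Require Import all_classical all_reals all_analysis.
From mathcomp Require Import ring lra.
Set Implicit Arguments.
Unset Strict Implicit.
Unset Printing Implicit Defensive.
Import Order.TTheory GRing.Theory Num.Theory.
Import numFieldNormedType.Exports.
Local Open Scope classical_set_scope.
Local Open Scope ring_scope.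

(** * Iterated differences of powers, along the projection of a box to a line *)

Section AlternatingSums.
Variable R : realType.
Implicit Types (w y : R) (ws : seq R) (f : R -> R).

(** The iterated forward difference of [f] with steps [ws]. Everything is scalar because a box
    enters only through the values a . x at its vertices. *)
Fixpoint alt_sum ws f y : R :=
  if ws is w :: ws' then alt_sum ws' f (y + w) - alt_sum ws' f y else f y.

Fixpoint vertex_sums ws y : seq R :=
  if ws is w :: ws' then vertex_sums ws' (y + w) ++ vertex_sums ws' y
  else [:: y].

(** Difference operators commute, so the outermost one can be moved onto [f], where it lowers the
    degree of a polynomial. *)
Lemma alt_sum_cons w ws f y :
  alt_sum (w :: ws) f y = alt_sum ws (fun s => f (s + w) - f s) y.
Proof.
elim: ws y => [//|w' ws IHws] y.
have -> : alt_sum (w :: w' :: ws) f y =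
    alt_sum (w :: ws) f (y + w') - alt_sum (w :: ws) f y.
  by rewrite /= (addrAC y); ring.
by rewrite !IHws.
Qed.

Lemma eq_alt_sum ws f g y : f =1 g -> alt_sum ws f y = alt_sum ws g y.
Proof. by move=> fg; elim: ws y => //= w ws IHws y; rewrite !IHws. Qed.

(** A difference with step w lowers the degree d by one and multiplies the leading coefficient by d
    * w; after d steps only a constant is left. *)
Lemma alt_sum_poly ws (p : {poly R}) y : (size p <= (size ws).+1)%N ->
  alt_sum ws (horner p) y = (size ws)`!%:R * p`_(size ws) * \prod_(w <- ws) w.
Proof.
elim: ws p => [|w ws IHws] p sp.
  by rewrite /= big_nil mulr1 mul1r (size1_polyC sp) hornerC coefC.
(* [q] is the Taylor expansion of p(s + w) - p(s) in powers of w; the term i = 0 has cancelled. *)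
set d := size ws; pose q := \sum_(1 <= i < d.+2) w ^+ i *: p^`N(i).
have psmall k : (d.+1 < k)%N -> p`_k = 0.
  by move=> dk; rewrite nth_default// (leq_trans sp).
have qE : (fun s => p.[s + w] - p.[s]) =1 horner q.
  move=> s; rewrite /= nderiv_taylor; last exact: mulrC.
  have -> : \sum_(i < size p) p^`N(i).[s] * w ^+ i =
            \sum_(0 <= i < d.+2) p^`N(i).[s] * w ^+ i.
    rewrite [RHS](@big_cat_nat _ _ _ (size p))//= big_mkord.
    rewrite [X in _ = _ + X]big_nat_cond [X in _ = _ + X]big1 ?addr0// => i.
    move=> /andP[/andP[pi _] _].
    suff -> : p^`N(i) = 0 by rewrite horner0 mul0r.
    apply/polyP => k; rewrite coef_nderivn coef0 nth_default ?mul0rn//.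
    exact: leq_trans pi (leq_addr _ _).
  rewrite big_ltn// nderivn0 expr0 mulr1 addrC addKr /q horner_sum.
  by apply: eq_bigr => i _; rewrite hornerZ mulrC.
(* From degree d on, only the term i = 1 contributes: those with i >= 2 involve coefficients of [p]
   beyond d + 1. *)
have qcoef k : (d <= k)%N -> q`_k = w * p`_(k.+1) *+ k.+1.
  move=> dk; rewrite /q coef_sum big_ltn// coefZ coef_nderivn expr1 add1n bin1.
  rewrite big_nat_cond big1 ?addr0 ?mulrnAr// => i /andP[/andP[i2 _] _].
  rewrite coefZ coef_nderivn psmall ?mul0rn ?mulr0//.
  by rewrite -add2n (leq_trans _ (leq_add i2 dk))// add2n.
rewrite alt_sum_cons (eq_alt_sum _ _ qE) IHws.
  rewrite qcoef// big_cons /= -/d factS natrM -mulr_natr; ring.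
apply/leq_sizeP => k dk; rewrite qcoef 1?ltnW// psmall ?mulr0 ?mul0rn//.
Qed.

Lemma alt_sum_mono ws (C : R) y :
  alt_sum ws (fun s => C * s ^+ size ws) y =
  (size ws)`!%:R * C * \prod_(w <- ws) w.
Proof.
rewrite (@eq_alt_sum _ _ (horner (C *: 'X^(size ws)))); last first.
  by move=> s /=; rewrite hornerZ hornerXn.
rewrite alt_sum_poly ?coefZ ?coefXn ?eqxx ?mulr1//.
by rewrite (leq_trans (size_scale_leq _ _))// size_polyXn.
Qed.

(** The first difference cancels the common residue [r], which is why the list has a head, and
    leaves an error below 1; each further difference at most doubles the error. *)
Lemma alt_sum_near_multiple (K r : R) w ws f y :
  (forall s, s \in vertex_sums (w :: ws) y ->
     exists z : int, 0 <= f s - (K * z%:~R + r) < 1) ->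
  exists z : int, `|alt_sum (w :: ws) f y - K * z%:~R| <= 2 ^+ size ws.
Proof.
elim: ws w y => [|w' ws IHws] w y fP.
  have [|z1 Hz1] := fP (y + w); first by rewrite /= !inE eqxx.
  have [|z2 Hz2] := fP y; first by rewrite /= !inE eqxx orbT.
  exists (z1 - z2); rewrite /= intrB expr0 ler_norml; lra.
have [s sP|z1 Hz1] := IHws w' (y + w).
  by apply: fP; rewrite /= mem_cat; apply/orP; left.
have [s sP|z2 Hz2] := IHws w' y.
  by apply: fP; rewrite /= mem_cat; apply/orP; right.
exists (z1 - z2).
have -> : alt_sum [:: w, w' & ws] f y - K * (z1 - z2)%:~R =
    (alt_sum (w' :: ws) f (y + w) - K * z1%:~R) -
    (alt_sum (w' :: ws) f y - K * z2%:~R).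
  by rewrite intrB /=; ring.
by rewrite (le_trans (ler_normB _ _))// exprS mulr_natl mulr2n lerD.
Qed.

(** The inclusion of [T] in [l] serves the induction: it keeps the new index [j] out of [T]. *)
Lemma vertex_sumsP (I : finType) (w : I -> R) (l : seq I) y s : uniq l ->
  s \in vertex_sums [seq w j | j <- l] y ->
  exists2 T : {set I}, {subset T <= l} & s = y + \sum_(j in T) w j.
Proof.
elim: l y => [|j l IHl] y /=.
  rewrite inE => _ /eqP ->; exists finset.set0.
    by move=> i; rewrite inE.
  by rewrite big_set0 addr0.
move=> /andP[jl ul]; rewrite mem_cat => /orP[] /(IHl _ ul)[T Tl ->].
  exists (j |: T)%SET.
    by move=> i; rewrite !inE => /orP[->//|/Tl ->]; rewrite orbT.
  rewrite big_setU1 ?addrA//.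
  by apply/negP => /Tl; apply/negP.
by exists T => // i /Tl il; rewrite inE il orbT.
Qed.

End AlternatingSums.

(** * A grid direction far from orthogonal to every edge *)

Section GoodDirection.
Variable R : realType.

Definition grid_dir n N (a : {ffun 'I_n -> 'I_N}) : 'rV[R]_n :=
  \row_i (a i)%:R.

Lemma dotDr n (a u v : 'rV[R]_n) : dot a (u + v) = dot a u + dot a v.
Proof.
by rewrite /dot -big_split; apply: eq_bigr => i _; rewrite mxE mulrDr.
Qed.

Lemma dot_sumr n (a : 'rV[R]_n) (I : finType) (T : {set I}) (v : I -> 'rV[R]_n) :
  dot a (\sum_(j in T) v j) = \sum_(j in T) dot a (v j).
Proof.
apply: (big_morph (dot a) (dotDr a)).
by rewrite /dot big1// => i _; rewrite mxE mulr0.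
Qed.

Lemma coord_le_euclid_norm n (v : 'rV[R]_n) i : `|v ord0 i| <= euclid_norm v.
Proof.
rewrite -sqrtr_sqr ler_wsqrtr// /dot (bigD1 i)//= expr2 lerDl sumr_ge0//.
by move=> j _; rewrite -expr2 sqr_ge0.
Qed.

Lemma euclid_norm_le n (v : 'rV[R]_n) (b : R) :
  (forall i, `|v ord0 i| <= b) -> euclid_norm v <= n%:R * b.
Proof.
case: n v => [|n] v vb; first by rewrite /euclid_norm /dot big_ord0 sqrtr0 mul0r.
have b0 : 0 <= b by apply: le_trans (vb ord0).
have nb0 : 0 <= n.+1%:R * b by rewrite mulr_ge0.
rewrite -(ger0_norm nb0) -sqrtr_sqr ler_wsqrtr//.
apply: (@le_trans _ _ (\sum_(i < n.+1) b ^+ 2)).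
  apply: ler_sum => i _; rewrite -expr2 -real_normK ?num_real//.
  by rewrite lerXn2r ?nnegrE.
rewrite sumr_const card_ord exprMn -[leLHS]mulr_natl ler_wpM2r ?sqr_ge0//.
by rewrite -natrX ler_nat expnS leq_pmulr ?expn_gt0.
Qed.

Lemma dot_grid_dir_le n N (a : {ffun 'I_n -> 'I_N.+1}) (v : 'rV[R]_n) :
  `|dot (grid_dir a) v| <= (n * N)%:R * euclid_norm v.
Proof.
rewrite /dot (le_trans (ler_norm_sum _ _ _))//.
apply: (@le_trans _ _ (\sum_(i < n) N%:R * euclid_norm v)).
  apply: ler_sum => i _; rewrite mxE normrM ler_pM ?coord_le_euclid_norm//.
  by rewrite ger0_norm// ler_nat -ltnS.
by rewrite sumr_const card_ord -[leLHS]mulr_natl mulrA natrM.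
Qed.

Lemma grid_dir_update n N (a : {ffun 'I_n -> 'I_N}) (v : 'rV[R]_n) (k : 'I_n) :
  dot (grid_dir a) v =
  (a k)%:R * v ord0 k + \sum_(i < n | i != k) (a i)%:R * v ord0 i.
Proof.
rewrite /dot (bigD1 k)//= mxE; congr (_ + _).
by apply: eq_bigr => i _; rewrite mxE.
Qed.

(* On each line of the grid parallel to the k-th axis, [dot a v] takes values
   that are at least |v_k| apart, so at most one point of the line is bad. *)
Lemma card_bad_dir n N (v : 'rV[R]_n) (k : 'I_n) :
  (#|[set a : {ffun 'I_n -> 'I_N} |
       (`|dot (grid_dir a) v| < `|v ord0 k| / 2)%R]%SET| * N <= N ^ n)%N.
Proof.
set B := finset _.
(* Overwriting coordinate [k] of a bad point by any of N values is injective, since the other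
   coordinates determine the bad point. Counting the image gives the bound. *)
pose upd (ac : {ffun 'I_n -> 'I_N} * 'I_N) : {ffun 'I_n -> 'I_N} :=
  [ffun i => if i == k then ac.2 else ac.1 i].
have upd_inj : {in finset.setX B [set: 'I_N]%SET &, injective upd}.
  move=> [a c] [b d]; rewrite !inE !andbT /= => aB bB /ffunP E.
  have := E k; rewrite !ffunE eqxx /= => <-; congr pair.
  have abE i : i != k -> a i = b i.
    by move=> /negbTE ik; have := E i; rewrite !ffunE ik.
  suff abk : a k = b k.
    by apply/ffunP => i; have [->//|/abE] := eqVneq i k.
  apply/eqP/negPn/negP => abk.
  move: aB bB; rewrite !(grid_dir_update _ _ k).
  rewrite [X in _ + X](eq_bigr (fun i => (b i)%:R * v ord0 i)); last first.
    by move=> i ik; rewrite abE.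
  set S := (X in _ + X); move=> aB bB.
  have : `|((a k)%:R - (b k)%:R) * v ord0 k| < `|v ord0 k|.
    have -> : ((a k)%:R - (b k)%:R) * v ord0 k =
      ((a k)%:R * v ord0 k + S) - ((b k)%:R * v ord0 k + S) by ring.
    by rewrite (le_lt_trans (ler_normB _ _))// [ltRHS]splitr ltrD.
  apply/negP; rewrite -leNgt normrM ler_peMl//.
  have : (a k != b k :> nat) by [].
  rewrite neq_ltn => /orP[] lt; [rewrite distrC|];
    rewrite ger0_norm ?subr_ge0 ?ler_nat 1?ltnW//;
    by rewrite -natrB 1?ltnW// ler1n subn_gt0.
have := max_card (mem (upd @: finset.setX B [set: 'I_N]%SET)).
by rewrite card_in_imset// cardsX cardsT card_ord card_ffun !card_ord.
Qed.

(** A union bound: each [v j] rules out at most a fraction 1/N of the grid, and there are fewer than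
    N of them. Badness is tested at the largest coordinate of [v j], which settles all [k]
    together. *)
Lemma good_grid_dir n N m (v : 'I_m -> 'rV[R]_n) : (m < N)%N ->
  exists a : {ffun 'I_n -> 'I_N},
    forall j k, `|v j ord0 k| / 2 <= `|dot (grid_dir a) (v j)|.
Proof.
case: n v => [|n] v mN.
  by exists (finfun (fun i : 'I_0 => False_rect _ (notF (valP i)))) => j [].
have /choice[k kmax] (j : 'I_m) :
    exists k, forall i, `|v j ord0 i| <= `|v j ord0 k|.
  case: (@Order.TotalTheory.arg_maxP _ _ _ ord0 xpredT
    (fun i => `|v j ord0 i|)) => // k _ kP.
  by exists k => i; exact: kP.
pose B j := [set a : {ffun 'I_n.+1 -> 'I_N} |
  `|dot (grid_dir a) (v j)| < `|v j ord0 (k j)| / 2]%SET.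
have N0 : (0 < N)%N by apply: leq_ltn_trans mN.
have cB : (#|(\bigcup_j B j)%SET| * N <= m * N ^ n.+1)%N.
  apply: (@leq_trans ((\sum_j #|B j|) * N)).
    rewrite leq_mul2r; apply/orP; right.
    elim/big_rec2: _ => [|j c D _ IH]; first by rewrite cards0.
    exact: leq_trans (leq_card_setU _ _) (leq_add (leqnn _) IH).
  rewrite big_distrl /= (@leq_trans (\sum_(j < m) N ^ n.+1))//.
    by apply: leq_sum => j _; exact: card_bad_dir.
  by rewrite sum_nat_const card_ord.
have [a aB] : exists a, a \notin (\bigcup_j B j)%SET.
  apply/existsP; rewrite -negb_forall; apply/negP => /forallP all.
  have E : (\bigcup_j B j)%SET = [set: {ffun 'I_n.+1 -> 'I_N}]%SET.
    by apply/setP => a; rewrite all inE.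
  move: cB; rewrite E cardsT card_ffun !card_ord mulnC leq_mul2r.
  by rewrite [(N <= m)%N]leqNgt mN orbF expn_eq0 eqn0Ngt N0.
exists a => j i; rewrite leNgt; apply/negP => lt.
case/negP: aB; apply/finset.bigcupP; exists j => //; rewrite inE.
by rewrite (lt_le_trans lt)// ler_wpM2r.
Qed.

End GoodDirection.

(** * Null sets for the Lebesgue outer measure; hyperplanes *)

Section OuterMeasure.
Variables (R : realType) (n : nat).
Implicit Types (A : set 'rV[R]_n.+1).

Lemma axis_box_volume_ge0 (a b : 'rV[R]_n.+1) :
  (forall i, a ord0 i <= b ord0 i) -> 0 <= axis_box_volume a b.
Proof. by move=> ab; apply: prodr_ge0 => i _; rewrite subr_ge0. Qed.

Lemma lebesgue_outer_ge0 A : (0 <= lebesgue_outer A)%E.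
Proof.
apply: le_ereal_inf_tmp => _ [a [b [ab _ ->]]].
by apply: nneseries_ge0 => k _ _; rewrite lee_fin axis_box_volume_ge0.
Qed.

Lemma lebesgue_outer0P A :
  (forall e : R, 0 < e -> (lebesgue_outer A <= e%:E)%E) -> lebesgue_outer A = 0%E.
Proof.
move=> Ae; apply/eqP; rewrite eq_le lebesgue_outer_ge0 andbT.
by apply/lee_addgt0Pr => e e0; rewrite add0e Ae.
Qed.

Lemma lebesgue_outer_le_esum (I : countType) (a b : I -> 'rV[R]_n.+1) A :
  (forall i k, a i ord0 k <= b i ord0 k) ->
  A `<=` \bigcup_i axis_box (a i) (b i) ->
  (lebesgue_outer A <= \esum_(i in [set: I]) (axis_box_volume (a i) (b i))%:E)%E.
Proof.
move=> ab Acov.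
(* Naturals that encode no index get the one-point box at the origin, of volume 0 because the
   dimension is positive. *)
pose ext (c : I -> 'rV[R]_n.+1) k := oapp c 0 (pickle_inv k).
have extK c i : ext c (pickle i) = c i by rewrite /ext pickleK_inv.
have ext_le k i : ext a k ord0 i <= ext b k ord0 i.
  by rewrite /ext; case: pickle_inv => //= j.
apply: (@le_trans _ _
  (\sum_(0 <= k <oo) (axis_box_volume (ext a k) (ext b k))%:E)%E).
  apply: ereal_inf_lbound; exists (ext a), (ext b); split=> // x /Acov[i _ xi].
  by exists (pickle i) => //; rewrite !extK.
rewrite nneseries_esumT; last first.
  by move=> k; rewrite lee_fin axis_box_volume_ge0.
have -> : (\esum_(i in [set: I]) (axis_box_volume (a i) (b i))%:E =
  \esum_(i in [set: I])
    (axis_box_volume (ext a (pickle i)) (ext b (pickle i)))%:E)%E.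
  by apply: eq_esum => i _; rewrite !extK.
have pickle_inj' : set_inj [set: I] (@pickle I).
  by apply: in2W; exact: (pcan_inj pickleK).
rewrite -(esum_image [set: I] pickle
  (fun k => (axis_box_volume (ext a k) (ext b k))%:E))//.
rewrite [leRHS]esum_mkcond; apply: le_esum => k _.
case: ifPn => // /negP kI.
suff kN : pickle_inv k = None :> option I.
  by rewrite /ext kN /axis_box_volume big_ord_recl subrr mul0r.
case E : (pickle_inv k) => [i|//]; case: kI; rewrite inE; exists i => //.
by have := @pickle_invK I k; rewrite E.
Qed.

Lemma lebesgue_outer_le_sum (I : finType) (a b : I -> 'rV[R]_n.+1) A :
  (forall i k, a i ord0 k <= b i ord0 k) ->
  A `<=` \bigcup_i axis_box (a i) (b i) ->
  (lebesgue_outer A <= (\sum_i axis_box_volume (a i) (b i))%:E)%E.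
Proof.
move=> ab Acov; apply: le_trans (lebesgue_outer_le_esum ab Acov) _.
rewrite esum_fset//; last 2 first.
- exact: finite_finset.
- by move=> i _; rewrite lee_fin axis_box_volume_ge0.
rewrite (fsbigE (index_enum I))//; last 2 first.
- exact: index_enum_uniq.
- by move=> i _; rewrite mem_index_enum.
by rewrite -sumEFin; under eq_bigl do rewrite in_setT.
Qed.

Lemma lebesgue_outer_set0 : lebesgue_outer (set0 : set 'rV[R]_n.+1) = 0%E.
Proof.
apply/eqP; rewrite eq_le lebesgue_outer_ge0 andbT.
have := @lebesgue_outer_le_sum void (fun=> 0) (fun=> 0) set0.
by rewrite big1 => [|[]]; apply.
Qed.

Lemma lebesgue_outer_sub A B :
  A `<=` B -> (lebesgue_outer A <= lebesgue_outer B)%E.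
Proof.
move=> AB; apply: le_ereal_inf_tmp => _ [a [b [ab Bcov ->]]].
by apply: ereal_inf_lbound; exists a, b; split=> //; exact: subset_trans Bcov.
Qed.

Lemma lebesgue_outer_bigcup0 (F : nat -> set 'rV[R]_n.+1) :
  (forall k, lebesgue_outer (F k) = 0%E) -> lebesgue_outer (\bigcup_k F k) = 0%E.
Proof.
move=> F0; apply: lebesgue_outer0P => e e0.
have cov k : exists ab : nat -> 'rV[R]_n.+1 * 'rV[R]_n.+1,
    [/\ forall l i, (ab l).1 ord0 i <= (ab l).2 ord0 i,
        F k `<=` \bigcup_l axis_box (ab l).1 (ab l).2
      & (\esum_(l in [set: nat]) (axis_box_volume (ab l).1 (ab l).2)%:E <=
         (e / (2 ^ k.+1)%:R)%:E)%E].
  have ek : 0 < e / (2 ^ k.+1)%:R by rewrite divr_gt0// ltr0n expn_gt0.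
  have : (lebesgue_outer (F k) < (e / (2 ^ k.+1)%:R)%:E)%E by rewrite F0 lte_fin.
  move=> /ereal_inf_lt[_ [a [b [ab Fcov ->]]]] lt_e.
  exists (fun l => (a l, b l)); split => //.
  rewrite -nneseries_esumT; first exact: ltW.
  by move=> l; rewrite lee_fin axis_box_volume_ge0//; exact: ab.
have {cov} /choice[ab abP] := cov.
apply: (@le_trans _ _ (\esum_(i in [set: nat * nat])
    (axis_box_volume (ab i.1 i.2).1 (ab i.1 i.2).2)%:E)%E).
  apply: (@lebesgue_outer_le_esum _
    (fun i : nat * nat => (ab i.1 i.2).1) (fun i => (ab i.1 i.2).2)).
    by move=> [k l] i; have [] := abP k.
  move=> x [k _ xk]; have [_ /(_ _ xk)[l _ xl] _] := abP k.
  by exists (k, l).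
have -> : [set: nat * nat] = [set: nat] `*`` (fun=> [set: nat]).
  by apply/seteqP; split.
rewrite -(@esum_esum _ _ _ _ _
  (fun k l => (axis_box_volume (ab k l).1 (ab k l).2)%:E)).
  apply: le_trans (@epsilon_trick0 R e xpredT (ltW e0)).
  rewrite [leRHS]nneseries_esumT; last first.
    by move=> k; rewrite lee_fin divr_ge0// ltW.
  by apply: le_esum => k _; have [] := abP k.
by move=> k l _ _; rewrite lee_fin axis_box_volume_ge0//; have [] := abP k.
Qed.

Lemma lebesgue_outer_bigcup0_count (I : countType) (F : I -> set 'rV[R]_n.+1) :
  (forall i, lebesgue_outer (F i) = 0%E) -> lebesgue_outer (\bigcup_i F i) = 0%E.
Proof.
move=> F0; pose G k := oapp F set0 (pickle_inv k).
apply/eqP; rewrite eq_le lebesgue_outer_ge0 andbT -(@lebesgue_outer_bigcup0 G).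
  apply: lebesgue_outer_sub => x [i _ xi].
  by exists (pickle i) => //; rewrite /G pickleK_inv.
by move=> k; rewrite /G; case: pickle_inv => [i|] /=;
  rewrite ?F0 ?lebesgue_outer_set0.
Qed.

(** Where [c] has a nonzero coordinate k, the hyperplane is the graph of x_k as a Lipschitz function
    of the other n coordinates. Over a unit cube cut into M^n subcubes of side 1/M, it is covered by
    boxes of height 2L/M, of total volume 2L/M. *)
Lemma lebesgue_outer_hyperplane (c : 'rV[R]_n.+1) (t : R) : c != 0 ->
  lebesgue_outer [set x | dot c x = t] = 0%E.
Proof.
move=> /rV0Pn[k ck].
pose H (z : {ffun 'I_n -> int}) := [set x : 'rV[R]_n.+1 | dot c x = t /\
  forall j, (z j)%:~R <= x ord0 (lift k j) < (z j)%:~R + 1].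
apply/eqP; rewrite eq_le lebesgue_outer_ge0 andbT.
rewrite -(@lebesgue_outer_bigcup0_count _ H); last first.
  move=> z; apply: lebesgue_outer0P => e e0.
  (* A Lipschitz constant of the graph for the sup norm; [M] is then chosen to make 2L/M at most
     e. *)
  pose L := \sum_j `|c ord0 (lift k j)| / `|c ord0 k|.
  have L0 : 0 <= L by apply: sumr_ge0 => j _; rewrite divr_ge0.
  pose M := (Num.truncn (2 * L / e)).+1.
  have M0 : 0 < M%:R :> R by rewrite ltr0n.
  have LM : 2 * L / M%:R <= e.
    have /truncn_itv/andP[_ /ltW] : 0 <= 2 * L / e.
      by rewrite divr_ge0 ?mulr_ge0// ltW.
    by rewrite ler_pdivrMr// => le; rewrite ler_pdivrMr// [leRHS]mulrC.
  (* [y g] is the lower corner of the subcube [g], and [s g] is the height of the hyperplane over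
     that corner. *)
  pose y (g : {ffun 'I_n -> 'I_M}) j : R := (z j)%:~R + (g j)%:R / M%:R.
  pose s g := (t - \sum_j c ord0 (lift k j) * y g j) / c ord0 k.
  pose a g : 'rV[R]_n.+1 := \row_i oapp (y g) (s g - L / M%:R) (unlift k i).
  pose b g : 'rV[R]_n.+1 :=
    \row_i oapp (fun j => y g j + M%:R^-1) (s g + L / M%:R) (unlift k i).
  have ab g i : a g ord0 i <= b g ord0 i.
    rewrite !mxE; case: unliftP => [j|] _ /=; first by rewrite lerDl invr_ge0 ltW.
    by rewrite lerD2l -subr_ge0 opprK addr_ge0// divr_ge0// ltW.
  have vol g : axis_box_volume (a g) (b g) = 2 * L / M%:R / M%:R ^+ n.
    rewrite /axis_box_volume (bigD1_ord k)//= !mxE unlift_none /=; congr (_ * _).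
      by rewrite -mulrA; ring.
    rewrite (eq_bigr (fun=> M%:R^-1)).
      by rewrite prodr_const card_ord exprVn.
    by move=> j _; rewrite !mxE liftK /= addrC addKr.
  apply: le_trans (lebesgue_outer_le_sum ab _) _.
    move=> x [xt xz].
    have /choice[g gP] (j : 'I_n) : exists g : 'I_M,
        (g%:R <= (x ord0 (lift k j) - (z j)%:~R) * M%:R < g%:R + 1).
      have /andP[zx xz1] := xz j; set u := _ * _.
      have u0 : 0 <= u by rewrite mulr_ge0 ?subr_ge0// ltW.
      have /andP[le_u lt_u] := truncn_itv u0.
      suff uM : (Num.truncn u < M)%N by exists (Ordinal uM);
        rewrite /= le_u -natr1 in lt_u *.
      rewrite -(ltr_nat R) (le_lt_trans le_u)// -[ltRHS]mul1r ltr_pM2r//.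
      by rewrite ltrBlDl.
    exists (finfun g) => //.
    have xy j : y (finfun g) j <= x ord0 (lift k j) <= y (finfun g) j + M%:R^-1.
      have /andP[] := gP j; rewrite /y ffunE -ler_pdivrMr// => le1 /ltW.
      by rewrite -ler_pdivlMr// mulrDl mul1r => le2; apply/andP; split; lra.
    have xs : `|x ord0 k - s (finfun g)| <= L / M%:R.
      have -> : x ord0 k - s (finfun g) =
          \sum_j c ord0 (lift k j) / c ord0 k *
            (y (finfun g) j - x ord0 (lift k j)).
        rewrite /s -xt /dot (bigD1_ord k)//=.
        under [RHS]eq_bigr do rewrite mulrAC.
        rewrite -mulr_suml.
        under [in RHS]eq_bigr do rewrite mulrBr.
        by rewrite sumrB; field.
      rewrite (le_trans (ler_norm_sum _ _ _))// mulr_suml; apply: ler_sum => j _.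
      rewrite !normrM normfV ler_pM// ?mulr_ge0//.
      by have := xy j; rewrite ler_norml; lra.
    move=> i; rewrite !mxE; case: unliftP => [j|] -> /=; first exact: xy.
    by move: xs; rewrite ler_norml; lra.
  rewrite lee_fin (eq_bigr _ (fun g _ => vol g)) sumr_const card_ffun !card_ord.
  by rewrite -[leLHS]mulr_natr natrX divfK// expf_neq0// gt_eqF.
apply: lebesgue_outer_sub => x /= xt.
exists [ffun j => Num.floor (x ord0 (lift k j))] => //; split => // j.
by rewrite ffunE -intrD1 floor_itv.
Qed.

End OuterMeasure.

(** * Color-classes as fibers of a map, and their boundaries *)

Lemma fibers_finite_coloring (R : realType) n (I : finType)
    (chi : 'rV[R]_n -> I) :
  finite_coloring [set A | A !=set0 /\ exists k, A = chi @^-1` [set k]].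
Proof.
split.
  apply: (@sub_finite_set _ _ ((fun k => chi @^-1` [set k]) @` [set: I])).
    by move=> A [_ [k ->]]; exists k.
  by apply: finite_image; exact: finite_finset.
split.
- apply/seteqP; split=> // x _; exists (chi @^-1` [set chi x]) => //=.
  by split; [exists x | exists (chi x)].
- move=> A B [_ [k ->]] [_ [l ->]] [x [/= xk xl]].
  by rewrite -xk -xl.
- by move=> A [].
Qed.

(** A fiber adherent to x takes the value chi x, hence contains a neighborhood of x. Boundaries thus
    consist of points where the coloring is not locally constant. *)
Lemma boundary_fiber (T : topologicalType) (I : Type)
    (chi : T -> I) (k : I) (x : T) :
  (\forall y \near x, chi y = chi x) -> ~ boundary (chi @^-1` [set k]) x.
Proof.
move=> chix [/(_ _ chix)[y [/= <- yx]]]; apply.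
by apply: filterS chix => z /= ->.
Qed.

Lemma floor_locally_constant (R : realType) (T : topologicalType)
    (f : T -> R) (x : T) :
  {for x, continuous f} -> f x != (Num.floor (f x))%:~R ->
  \forall y \near x, Num.floor (f y) = Num.floor (f x).
Proof.
move=> fx xN; have /andP[le_f lt_f] := floor_itv (f x).
have lt_f' : (Num.floor (f x))%:~R < f x by rewrite lt_neqAle eq_sym xN.
have near_lt : \forall y \near x, f y < (Num.floor (f x) + 1)%:~R.
  exact: (fx _ (lt_nbhsl lt_f)).
have near_gt : \forall y \near x, (Num.floor (f x))%:~R < f y.
  exact: (fx _ (lt_nbhsr lt_f')).
near=> y; apply/eqP; rewrite eq_le -ltzD1 floor_lt_int floor_ge_int.
by apply/andP; split; [near: y | apply: ltW; near: y].
Unshelve. all: by end_near. Qed.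

(** * The coloring by residues, and the walls between its classes *)

Section Coloring.
Variables (R : realType) (n : nat) (C : R) (K : nat).

Definition phase (m : nat) (a : {ffun 'I_n -> 'I_n.+1}) (x : 'rV[R]_n) : R :=
  C * dot (grid_dir R a) x ^+ m.

(** The remainder modulo K + 1 lies between 0 and K, so neither the absolute value nor [inord]
    alters it. *)
Definition phase_residue m a x : 'I_K.+1 :=
  inord `|(Num.floor (phase m a x) %% K.+1%:Z)%Z|.

(** All directions and exponents are recorded at once, since the good direction depends on the box
    and the exponent is its dimension. *)
Definition color (x : 'rV[R]_n) :
    {ffun {ffun 'I_n -> 'I_n.+1} * 'I_n.+1 -> 'I_K.+1} :=
  [ffun am : {ffun 'I_n -> 'I_n.+1} * 'I_n.+1 => phase_residue am.2 am.1 x].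

Lemma phase_residueP m a x : exists z : int,
  0 <= phase m a x - (K.+1%:R * z%:~R + (phase_residue m a x)%:R) < 1.
Proof.
set d := K.+1%:Z; set f := Num.floor (phase m a x).
exists (f %/ d)%Z; rewrite /phase_residue -/f -/d.
have d0 : (f %% d)%Z < d by rewrite ltz_pmod.
have m0 : 0 <= (f %% d)%Z by rewrite modz_ge0.
rewrite inordK; last by rewrite -ltz_nat gez0_abs.
have -> : K.+1%:R * (f %/ d)%Z%:~R + `|(f %% d)%Z|%N%:R = f%:~R :> R.
  rewrite [in RHS](divz_eq f d) intrD intrM mulrC.
  by congr (_ + _); rewrite -[in RHS](gez0_abs m0).
have /andP[] := floor_itv (phase m a x).
by rewrite -/f intrD1 subr_ge0 ltrBlDl addrC => -> ->.
Qed.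

Lemma continuous_phase m a : continuous (phase m a).
Proof.
have dot_cont : continuous (dot (grid_dir R a)).
  apply: continuous_big => [|i _ y]; first exact: add_continuous.
  exact: (cvg_comp _ _ (@coord_continuous R 1 n ord0 i y)
    (@mulrl_continuous R _ _)).
move=> x; have pow_cont := cvg_comp _ _ (dot_cont x)
  (@exprn_continuous R m (dot (grid_dir R a) x)).
exact: (cvg_comp _ _ pow_cont (@mulrl_continuous R C _)).
Qed.

(** If C * (a . x)^m is the integer z, then a . x is one of the two signed m-th roots of |z| / C.
    Fixing the sign [s] puts each wall in one hyperplane, and the index type stays countable. *)
Definition phase_wall
    (i : {ffun 'I_n -> 'I_n.+1} * 'I_n.+1 * (bool * int)) : set 'rV[R]_n :=
  let: (a, m, (s, z)) := i in
  [set x | [/\ grid_dir R a != 0, (0 < m)%N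
    & dot (grid_dir R a) x = (-1) ^+ s * (`|z%:~R| / C) `^ m%:R^-1]].

(** Phases with a = 0 or m = 0 are constant; off the walls every other phase is non-integral at [x],
    so its floor is constant nearby. Finitely many neighborhoods are then intersected. *)
Lemma color_locally_constant x : 0 < C -> ~ (\bigcup_i phase_wall i) x ->
  \forall y \near x, color y = color x.
Proof.
move=> C0 xW.
have floor_near (am : {ffun 'I_n -> 'I_n.+1} * 'I_n.+1) : \forall y \near x,
    Num.floor (phase am.2 am.1 y) = Num.floor (phase am.2 am.1 x).
  case: am => a m /=.
  have [a0|a0] := eqVneq (grid_dir R a) 0.
    have dot0 y : dot (grid_dir R a) y = 0.
      by rewrite a0 /dot big1// => i _; rewrite mxE mul0r.
    by apply: (@nearW _ _ _ (nbhs_filter x)) => y; rewrite /phase !dot0.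
  case: (posnP m) => [m0|m0].
    by apply: (@nearW _ _ _ (nbhs_filter x)) => y; rewrite /phase m0 !expr0.
  apply: floor_locally_constant; first exact: continuous_phase.
  apply/eqP; set z := Num.floor _; set t := dot (grid_dir R a) x => zE.
  apply: xW; exists (a, m, (t < 0, z)) => //=; split => //.
  rewrite -zE normrM (gtr0_norm C0) [C * _]mulrC mulfK ?gt_eqF// normrX.
  rewrite -(powR_mulrn m (normr_ge0 t)) -powRrM.
  rewrite divff ?pnatr_eq0 -?lt0n// powRr1//.
  exact: numEsign.
have := @filter_forall _ _ _ _ (nbhs_filter x) floor_near.
apply: filterS => y yx; apply/ffunP => am; rewrite !ffunE /phase_residue.
by rewrite yx.
Qed.

End Coloring.

Lemma lebesgue_outer_boundary_color (R : realType) n (C : R) K k :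
  0 < C ->
  lebesgue_outer (boundary (@color R n.+1 C K @^-1` [set k])) = 0%E.
Proof.
move=> C0; apply/eqP; rewrite eq_le lebesgue_outer_ge0 andbT.
rewrite -(@lebesgue_outer_bigcup0_count _ _ _ (@phase_wall R n.+1 C)).
  apply: lebesgue_outer_sub => x bx.
  have [//|xW] := pselect ((\bigcup_i phase_wall C i) x).
  by case: (boundary_fiber (color_locally_constant K C0 xW) bx).
case=> [[a m] [s z]]; have [a0|a0] := eqVneq (grid_dir R a) 0.
  rewrite (_ : phase_wall _ _ = set0) ?lebesgue_outer_set0//.
  by apply/seteqP; split=> // x [/eqP].
apply/eqP; rewrite eq_le lebesgue_outer_ge0 andbT.
rewrite -(lebesgue_outer_hyperplane ((-1) ^+ s * (`|z%:~R| / C) `^ m%:R^-1) a0).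
by apply: lebesgue_outer_sub => x [].
Qed.

(** * Exclusion of monochromatic boxes of volume 1 *)

(** This is how volume 1 enters: the lengths [e j] multiply to 1 and drop out of the bounds. *)
Lemma prod_norm_bounds (R : realType) m (w e : 'I_m -> R) (lo hi : R) :
  0 <= lo -> (forall j, 0 <= e j) ->
  (forall j, lo * e j <= `|w j| <= hi * e j) -> \prod_j e j = 1 ->
  lo ^+ m <= `|\prod_j w j| <= hi ^+ m.
Proof.
move=> lo0 e0 we e1; rewrite normr_prod.
have prodc c : \prod_j (c * e j) = c ^+ m.
  by rewrite big_split /= prodr_const card_ord e1 mulr1.
rewrite -!prodc; apply/andP; split; apply: ler_prod => j _.
  by have /andP[-> _] := we j; rewrite mulr_ge0.
by have /andP[_ ->] := we j; rewrite normr_ge0.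
Qed.

Lemma no_monochromatic_box (R : realType) n (C : R) K k m
    (p : 'rV[R]_n) (v : 'I_m -> 'rV[R]_n) :
  (0 < m <= n)%N -> 2 ^+ n * (2 * n)%:R ^+ n < C ->
  n`!%:R * C * (n * n)%:R ^+ n + 2 ^+ n < K.+1%:R ->
  rectangular_box_volume v = 1 ->
  ~ rectangular_box_vertices p v `<=` color C K @^-1` [set k].
Proof.
move=> /andP[m0 mn] CP KP v1 mono.
have n0 : (0 < n)%N := leq_trans m0 mn.
have C0 : 0 < C by apply: le_lt_trans CP; rewrite mulr_ge0// exprn_ge0.
have [a aP] := good_grid_dir v (leq_ltn_trans mn (ltnSn n)).
have mn1 : (m < n.+1)%N by [].
set w := fun j => dot (grid_dir R a) (v j).
(* The factor 2n comes from |v| <= n * max |v_k| <= 2n * |a . v|; the factor n * n from n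
   coordinates of [a], each at most n. *)
have /andP[lo hi] : (2 * n)%:R^-1 ^+ m <= `|\prod_j w j| <= (n * n)%:R ^+ m.
  apply: (prod_norm_bounds _ _ _ v1) => [|j|j].
  - by rewrite invr_ge0.
  - exact: sqrtr_ge0.
  - rewrite dot_grid_dir_le andbT ler_pdivrMl; last by rewrite ltr0n muln_gt0 n0.
    rewrite mulnC natrM -mulrA; apply: euclid_norm_le => i.
    by have := aP j i; rewrite /w; lra.
have fact_le : m`!%:R <= n`!%:R :> R by rewrite ler_nat leq_fact.
have fact_ge1 : 1 <= m`!%:R :> R by rewrite ler1n fact_gt0.
pose f s := C * s ^+ m.
pose ws := [seq w j | j <- enum 'I_m].
have size_ws : size ws = m by rewrite size_map size_enum_ord.
set y := dot (grid_dir R a) p.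
have f_res s : s \in vertex_sums ws y -> exists z : int,
    0 <= f s - (K.+1%:R * z%:~R + (k (a, Ordinal mn1))%:R) < 1.
  case/(vertex_sumsP (enum_uniq _)) => T _ ->.
  rewrite -dot_sumr -dotDr.
  have -> : k (a, Ordinal mn1) = phase_residue C K m a (p + \sum_(j in T) v j).
    have <- : color C K (p + \sum_(j in T) v j) = k by apply: mono; exists T.
    by rewrite ffunE.
  exact: phase_residueP.
have altE : alt_sum ws f y = m`!%:R * C * \prod_j w j.
  have := alt_sum_mono ws C y; rewrite size_ws => ->.
  by rewrite big_map big_enum.
have [z] : exists z : int, `|alt_sum ws f y - K.+1%:R * z%:~R| <= 2 ^+ n.
  case: ws size_ws f_res {altE} => [m_eq0|w0 ws' size_ws f_res].
    by rewrite -m_eq0 in m0.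
  have [z zP] := alt_sum_near_multiple f_res; exists z.
  rewrite (le_trans zP)// ler_eXn2l ?ltr1n//.
  by move: mn; rewrite -size_ws => /ltnW.
have absE : `|alt_sum ws f y| = m`!%:R * C * `|\prod_j w j|.
  by rewrite altE !normrM (gtr0_norm C0) ger0_norm.
have pow_le (b : R) : 1 <= b -> b ^+ m <= b ^+ n by move=> b1; exact: ler_weXn2l.
have nn1 : 1 <= (n * n)%:R :> R by rewrite ler1n muln_gt0 n0.
have alt_small : `|alt_sum ws f y| <= n`!%:R * C * (n * n)%:R ^+ n.
  rewrite absE ler_pM ?mulr_ge0 ?ler_wpM2r ?(ltW C0)//.
  exact: le_trans hi (pow_le _ nn1).
(* A nonzero multiple of K + 1 is too large to lie within 2^n of the alternating sum. *)
have [->|z0] := eqVneq z 0; last first.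
  have : K.+1%:R <= `|K.+1%:R * z%:~R| :> R.
    rewrite normrM ger0_norm// ler_peMr// -intr_norm ler1z.
    by rewrite -gtz0_ge1 normr_gt0.
  move=> Kz altz.
  have := ler_normD (K.+1%:R * z%:~R - alt_sum ws f y) (alt_sum ws f y).
  rewrite subrK distrC; lra.
(* With z = 0 the alternating sum would be at most 2^n, but it is at least C / (2n)^m, which exceeds
   2^n by the choice of [C]. *)
rewrite mulr0 subr0 leNgt => /negP; apply.
have n2 : 1 <= (2 * n)%:R :> R by rewrite ler1n muln_gt0 n0.
rewrite absE (@lt_le_trans _ _ (C * (2 * n)%:R^-1 ^+ m))//.
  rewrite exprVn ltr_pdivlMr; last by rewrite exprn_gt0// (lt_le_trans ltr01).
  by apply: le_lt_trans CP; rewrite ler_wpM2l ?exprn_ge0// pow_le.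
by rewrite ler_pM ?ler_peMl ?exprn_ge0 ?invr_ge0 ?(ltW C0).
Qed.

Theorem theorem4 (R : realType) (n : nat) (hn : (0 < n)%N) :
  exists P : set (set 'rV[R]_n),
    jordan_measurable_coloring P /\
    forall m : nat, (0 < m)%N -> (m <= n)%N ->
      ~ exists (p : 'rV[R]_n) (v : 'I_m -> 'rV[R]_n),
          [/\ rectangular_edges v,
              rectangular_box_volume v = 1
            & exists2 A, P A & rectangular_box_vertices p v `<=` A].
Proof.
case: n hn => [//|n] _.
(* The added 1 makes the lower bound on [C] strict; for [K], truncation suffices because the modulus
   is K + 1. *)
pose C : R := 2 ^+ n.+1 * (2 * n.+1)%:R ^+ n.+1 + 1.
have C0 : 0 < C by rewrite ltr_wpDl// mulr_ge0// exprn_ge0.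
pose K := Num.truncn (n.+1`!%:R * C * (n.+1 * n.+1)%:R ^+ n.+1 + 2 ^+ n.+1).
exists [set A | A !=set0 /\ exists k, A = color C K @^-1` [set k]]; split.
  split; first exact: fibers_finite_coloring.
  by move=> A [_ [k ->]]; exact: lebesgue_outer_boundary_color.
move=> m m0 mn [p [v [_ v1 [A [_ [k ->]]]]]].
apply: (no_monochromatic_box _ _ _ v1); rewrite ?m0//.
  by rewrite ltrDl.
have /truncn_itv/andP[] // :
  0 <= n.+1`!%:R * C * (n.+1 * n.+1)%:R ^+ n.+1 + 2 ^+ n.+1.
by rewrite addr_ge0 ?exprn_ge0// !mulr_ge0 ?(ltW C0) ?exprn_ge0.
Qed.
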